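(* Let $\mathcal{G}=(\mathcal{V},\mathcal{E},\omega)$ be a finite undirected weighted graph with vertex-to-edge incidence map $\nabla$ and $K=\operatorname{diag}(\omega)\nabla$. Let $\mathcal{E}=\bigsqcup_{l=1}^L\mathcal{E}_l$ be a partition of the edge set into $L$ nonempty subsets such that each subgraph $\mathcal{G}_l=(\mathcal{V},\mathcal{E}_l,\omega|_{\mathcal{E}_l})$ is a forest, and let $\Pi_l=\nabla_l^\top(\nabla_l\nabla_l^\top)^{-1}\nabla_l$ for $l=1,\dots,L$. Suppose the forests are nested in the sense that, for some index $\hat l$ with $1\le\hat l<L$, $$\operatorname{ran}\Pi_1=\cdots=\operatorname{ran}\Pi_{\hat l}\supsetneq\operatorname{ran}\Pi_{\hat l+1}\supseteq\cdots\supseteq\operatorname{ran}\Pi_L .$$ Let $T=\sum_{l=1}^LP_l^\top K_lK_l^\top P_l$. Then $\kappa(T^{-1/2}K)=\sqrt{L/\hat l}$.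
   Context: The edges of $\mathcal{G}$ carry weights $\omega:\mathcal{E}\to(0,\infty)$. The matrix $\nabla:\mathbb{R}^{\mathcal{V}}\to\mathbb{R}^{\mathcal{E}}$ is the (transposed) incidence matrix, $(\nabla u)_e=u_i-u_j$ for each edge $e=(i,j)\in\mathcal{E}$, with an arbitrarily fixed orientation of each edge. For each $l$, $P_l:\mathbb{R}^{\mathcal{E}}\to\mathbb{R}^{\mathcal{E}_l}$ is the canonical projection (restriction) $P_lp=p|_{\mathcal{E}_l}$, and $\nabla_l=P_l\nabla$, $K_l=P_lK$. A forest is a graph with no cycle; for a forest $\mathcal{G}_l$, $\nabla_l^\top$ has full column rank, so $\nabla_l\nabla_l^\top$ and $K_lK_l^\top$ are invertible, and $\Pi_l$ is the orthogonal projection onto $\operatorname{ran}\nabla_l^\top$. For a nonzero real matrix $A$, the (finite) condition number is $\kappa(A)=\sigma_{\max}(A)/\sigma_{\min>0}(A)$, the ratio of the largest to the smallest nonzero singular value. *)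

(* Defs.v *)
From HB Require Import structures.
From mathcomp Require Import all_boot all_order all_algebra.
From mathcomp Require Import mathcomp_extra boolp classical_sets reals.

Set Implicit Arguments.
Unset Strict Implicit.
Unset Printing Implicit Defensive.

Import Order.TTheory GRing.Theory Num.Theory.

Local Open Scope classical_set_scope.
Local Open Scope ring_scope.

(* Finite simple weighted graph with vertices 'I_n and edges 'I_m; each edge   *)
(* carries an arbitrary orientation from wg_src to wg_tgt.                     *)
Record wgraph (R : realType) (n m : nat) := WGraph {
  wg_src : 'I_m -> 'I_n;
  wg_tgt : 'I_m -> 'I_n;
  wg_weight : 'I_m -> R;
  wg_noloop : forall e, wg_src e != wg_tgt e;
  wg_simple : forall e f,
    (wg_src e = wg_src f /\ wg_tgt e = wg_tgt f) \/
    (wg_src e = wg_tgt f /\ wg_tgt e = wg_src f) -> e = f;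
  wg_weight_gt0 : forall e, 0 < wg_weight e
}.

Section Graph.
Variables (R : realType) (n m : nat) (G : wgraph R n m).

Definition incidence : 'M[R]_(m, n) :=
  \matrix_(e, i) ((i == wg_src G e)%:R - (i == wg_tgt G e)%:R).

Definition wincidence : 'M[R]_(m, n) :=
  diag_mx (\row_e wg_weight G e) *m incidence.

Definition sub_adj (S : {set 'I_m}) : rel 'I_n := fun i j =>
  [exists e in S, ((wg_src G e == i) && (wg_tgt G e == j))
               || ((wg_src G e == j) && (wg_tgt G e == i))].

(* As the graph is simple, its cycles are the closed walks through k >= 3      *)
(* distinct vertices; the bound excludes traversing one edge back and forth.   *)
Definition is_forest (S : {set 'I_m}) : Prop :=
  forall s : seq 'I_n, (2 < size s)%N -> ~ ucycle (sub_adj S) s.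

(* R^S is identified with 'cV_#|S| through the enumeration of S. *)
Definition restr (S : {set 'I_m}) : 'M[R]_(#|S|, m) :=
  \matrix_(i, e) (enum_val i == e)%:R.

Definition sub_incidence (S : {set 'I_m}) : 'M[R]_(#|S|, n) :=
  restr S *m incidence.

Definition sub_wincidence (S : {set 'I_m}) : 'M[R]_(#|S|, n) :=
  restr S *m wincidence.

Definition forest_proj (S : {set 'I_m}) : 'M[R]_n :=
  (sub_incidence S)^T
    *m invmx (sub_incidence S *m (sub_incidence S)^T) *m sub_incidence S.

Definition precond (L : nat) (E : 'I_L -> {set 'I_m}) : 'M[R]_m :=
  \sum_(l < L) (restr (E l))^T
    *m (sub_wincidence (E l) *m (sub_wincidence (E l))^T) *m restr (E l).

End Graph.

Definition edge_partition (m L : nat) (E : 'I_L -> {set 'I_m}) : Prop :=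
  (forall l, (0 < #|E l|)%N) /\ (forall e, exists! l, e \in E l).

Section RealMatrix.
Variable R : realType.

Definition ran (p q : nat) (A : 'M[R]_(p, q)) : set 'cV[R]_p :=
  range (fun x : 'cV[R]_q => A *m x).

Definition psd (p : nat) (A : 'M[R]_p) : Prop :=
  A^T = A /\ forall x : 'cV[R]_p, 0 <= (x^T *m A *m x) ord0 ord0.

(* The symmetric positive semidefinite square root, which exists and is unique *)
(* when A is itself psd (the value is 0 when there is none).                   *)
Definition sqrtmx (p : nat) (A : 'M[R]_p) : 'M[R]_p :=
  xget 0 [set S | psd S /\ S *m S = A].

(* Taking A^T A rather than A A^T only affects whether 0 is a singular value.  *)
Definition singular_value (p q : nat) (A : 'M[R]_(p, q)) : set R :=
  [set s | 0 <= s /\ eigenvalue (A^T *m A) (s ^+ 2)].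

(* For A != 0 both sets are finite and nonempty, so that sup and inf are       *)
(* respectively a maximum and a minimum.                                       *)
Definition sigma_max (p q : nat) (A : 'M[R]_(p, q)) : R :=
  sup (singular_value A).

Definition sigma_minpos (p q : nat) (A : 'M[R]_(p, q)) : R :=
  inf [set s | singular_value A s /\ s != 0].

Definition cond_number (p q : nat) (A : 'M[R]_(p, q)) : R :=
  sigma_max A / sigma_minpos A.

End RealMatrix.

(* Main.v *)
Require Import Defs.
From mathcomp Require Import all_boot all_order all_algebra.
From mathcomp Require Import mathcomp_extra boolp classical_sets reals.
From mathcomp Require Import complex spectral sesquilinear.

(** The condition number of A = T^{-1/2} K is read off the spectrum of A^T A.

    Both T and its square root are symmetric, so A^T A = K^T T^{-1} K.  The
    edge classes are disjoint, hence T is block diagonal with blocks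
    K_l K_l^T, and T^{-1} is block diagonal with the inverse blocks.  This gives
    A^T A = sum_l K_l^T (K_l K_l^T)^{-1} K_l.  On each class K_l is an
    invertible diagonal matrix times the incidence matrix of the forest, and
    the weights cancel: A^T A = sum_l Pi_l (preconditioned_gram).  The blocks
    are invertible because the incidence matrix of a forest has independent
    rows: the support of a nontrivial relation between rows would be a
    subgraph in which no vertex has degree one, and such a graph has a cycle
    (min_degree2_cycle, forest_row_free).

    It remains to find the extreme nonzero eigenvalues of a sum M of L nested
    orthogonal projections, the first lh of which coincide.  If M x = a x with
    a != 0, then x lies in the largest range, so the first lh projections fix
    x, and a |x|^2 = sum_l |Pi_l x|^2 lies between lh |x|^2 and L |x|^2.  The
    bound L is attained on the smallest range, which is nonzero as no class is
    empty; the bound lh is attained on the part of the largest range that is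
    orthogonal to the next one, which is nonzero as the inclusion is strict.
    So the condition number is sqrt L / sqrt lh.

    The square root of T must also be shown to exist.  It is obtained as a
    polynomial in T: the spectral theorem over the complex numbers diagonalizes
    T with nonnegative real eigenvalues, and a real polynomial r interpolating
    the fourth root at these satisfies r(T)^4 = T, so that r(T)^2 is a
    symmetric positive semidefinite square root (psd_sqrt_exists). *)

Set Implicit Arguments.
Unset Strict Implicit.
Unset Printing Implicit Defensive.

Import Order.TTheory GRing.Theory Num.Theory.

Local Open Scope classical_set_scope.
Local Open Scope ring_scope.

(** * Square roots of positive semidefinite matrices *)

Lemma interpolation (F : fieldType) (g : F -> F) (s : seq F) :
  exists p : {poly F}, forall a, a \in s -> p.[a] = g a.
Proof.
elim: s => [|a s [p ph]]; first by exists 0.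
have [as_|as_] := boolP (a \in s).
  by exists p => b; rewrite inE => /predU1P [->|]; apply: ph.
pose w := \prod_(b <- s) ('X - b%:P).
have wa : w.[a] != 0 by rewrite -/(root w a) root_prod_XsubC.
exists (p + ((g a - p.[a]) / w.[a]) *: w) => b.
rewrite inE hornerD hornerZ => /predU1P [->|bs].
  by rewrite divfK // subrKC.
have /rootP -> : root w b by rewrite root_prod_XsubC.
by rewrite mulr0 addr0 ph.
Qed.

Lemma horner_mx_tr (F : comNzRingType) n (A : 'M[F]_n.+1) (p : {poly F}) :
  (horner_mx A p)^T = horner_mx A^T p.
Proof.
elim/poly_ind: p => [|p c IH]; first by rewrite !rmorph0 trmx0.
rewrite !rmorphD !rmorphM /= !horner_mx_C !horner_mx_X linearD /= tr_scalar_mx.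
rewrite -[in LHS]mulmxE trmx_mul IH; congr (_ + _).
by rewrite mulmxE; apply: comm_mx_horner.
Qed.

Lemma sqnorm_ge0 (F : realDomainType) p (x : 'cV[F]_p) :
  0 <= (x^T *m x) ord0 ord0.
Proof.
by rewrite mxE sumr_ge0 // => i _; rewrite mxE -expr2 sqr_ge0.
Qed.

Lemma sqnorm_eq0 (F : realDomainType) p (x : 'cV[F]_p) :
  ((x^T *m x) ord0 ord0 == 0) = (x == 0).
Proof.
apply/eqP/eqP => [|->]; last by rewrite mulmx0 mxE.
rewrite mxE => /eqP; rewrite psumr_eq0; last first.
  by move=> i _; rewrite mxE -expr2 sqr_ge0.
move=> /allP h; apply/matrixP => i j; rewrite ord1 !mxE.
have /h := mem_index_enum i.
by rewrite /= mxE -expr2 sqrf_eq0 => /eqP.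
Qed.

Lemma sqnorm_gt0 (F : realDomainType) p (x : 'cV[F]_p) :
  (0 < (x^T *m x) ord0 ord0) = (x != 0).
Proof. by rewrite lt_def sqnorm_eq0 sqnorm_ge0 andbT. Qed.

Lemma psd_eigenvalue_ge0 (R : realType) p (A : 'M[R]_p) a :
  psd A -> eigenvalue A a -> 0 <= a.
Proof.
move=> [_ pA] /eigenvalueP [v vA v0].
have := pA v^T; rewrite trmxK vA -scalemxAl mxE pmulr_lge0 //.
by have := sqnorm_gt0 v^T; rewrite trmxK trmx_eq0 v0.
Qed.

Lemma psd_gram (R : realType) p q (A : 'M[R]_(p, q)) : psd (A *m A^T).
Proof.
split=> [|x]; first by rewrite trmx_mul trmxK.
by rewrite mulmxA -mulmxA -{1}[A]trmxK -trmx_mul sqnorm_ge0.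
Qed.

(** Taking r(A) r(A)^T with r the fourth root on the spectrum, rather than r(A)
    with r the square root, makes positivity immediate: it is a Gram matrix.
    Complex numbers enter only to diagonalize A; the eigenvalues are real, so r
    has real coefficients and r(A) is a real matrix. *)
Lemma psd_sqrt_exists (R : realType) p (A : 'M[R]_p) :
  psd A -> exists S, psd S /\ S *m S = A.
Proof.
case: p A => [|p] A pA.
  exists 0; split; last by apply/matrixP => -[].
  by split=> [|x]; [rewrite trmx0 | rewrite mulmx0 mul0mx mxE].
pose f : {rmorphism R -> R[i]%C} := real_complex R.
pose Ac := map_mx f A.
have Asym : A^T = A by case: pA.
have Aherm : Ac \is hermsymmx.
  apply/is_hermitianmxP; rewrite expr0 scale1r.
  apply/matrixP => i j; rewrite !mxE -{1}Asym mxE /=.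
  by apply/esym/CrealP/complex_realP; exists (A j i).
have /orthomx_spectralP := hermitian_normalmx Aherm.
have /mxOverP dR := hermitian_spectral_diag_real Aherm.
have Pu := spectral_unit Ac.
move: (spectralmx Ac) (spectral_diag Ac) Pu dR => P d Pu dR AcE.
have dE i : exists2 a : R, 0 <= a & d 0 i = f a.
  have /complex_realP [a da] := dR 0 i; exists a => //.
  apply: (psd_eigenvalue_ge0 pA).
  (* The characteristic polynomial is the same over R and over R[i], so the
     diagonal entry is an eigenvalue of the real matrix A. *)
  rewrite eigenvalue_root_char -(fmorph_root f) map_char_poly -/Ac -[f a]da.
  rewrite -eigenvalue_root_char; apply/eigenvalueP.
  exists (delta_mx 0 i *m P); last first.
    by apply/eqP => /(congr1 (mulmx^~ (invmx P))); rewrite mulmxK // mul0mx =>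
      /matrixP /(_ 0 i); rewrite !mxE !eqxx => /eqP; rewrite oner_eq0.
  by rewrite AcE !mulmxA mulmxK // -(rowE i (diag_mx d)) row_diag_mx -scalemxAl.
pose s := [seq complex.Re (d 0 i) | i : 'I_p.+1].
have [r rs] := interpolation (fun a => Num.sqrt (Num.sqrt a)) s.
have r4 : horner_mx A (r ^+ 4) = A.
  apply/eqP; rewrite -subr_eq0 -[X in _ - X](horner_mx_X A) -(rmorphB (horner_mx A)) /=.
  rewrite -(map_mx_eq0 f) map_horner_mx -/Ac AcE.
  rewrite (horner_mx_uconjC _ _ Pu) horner_mx_diag.
  set D := map_mx _ d; suff -> : D = 0 by rewrite linear0 mulmx0 mul0mx.
  apply/matrixP => i j; rewrite ord1 !mxE.
  have [a a0 da] := dE j.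
  rewrite da horner_map !hornerE.
  have -> : r.[a] = Num.sqrt (Num.sqrt a).
    apply: rs; apply/mapP; exists j; first by rewrite mem_enum.
    by rewrite da.
  by rewrite -[4%N]/(2 * 2)%N exprM !sqr_sqrtr ?sqrtr_ge0 // subrr.
have rsym : (horner_mx A r)^T = horner_mx A r by rewrite horner_mx_tr Asym.
exists (horner_mx A r *m (horner_mx A r)^T); split; first exact: psd_gram.
by rewrite rsym !mulmxE -!expr2 -exprM -rmorphXn.
Qed.

Lemma sqrtmxP (R : realType) p (A : 'M[R]_p) :
  psd A -> psd (sqrtmx A) /\ sqrtmx A *m sqrtmx A = A.
Proof. by move=> /psd_sqrt_exists /(xgetPex 0). Qed.

(** * Independence of the incidence rows of a forest *)

(** A row v killed by A A^T satisfies |v A|^2 = v A A^T v^T = 0. *)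
Lemma gram_unitmx (F : realFieldType) p q (A : 'M[F]_(p, q)) :
  row_free A -> A *m A^T \in unitmx.
Proof.
rewrite -row_free_unit -!kermx_eq0 => /eqP kA.
apply/eqP/row_matrixP => i; rewrite row0.
set v := row i _; have vAA : v *m (A *m A^T) = 0.
  by apply/sub_kermxP; rewrite row_sub.
have vA : v *m A = 0.
  apply/eqP; rewrite -trmx_eq0 -sqnorm_eq0 trmxK trmx_mul.
  by rewrite -mulmxA (mulmxA A) mulmxA vAA mul0mx mxE.
by apply/eqP; rewrite -submx0 -kA; apply/sub_kermxP.
Qed.

(** Extend a simple path at its head as long as possible: the head has a
    neighbour other than the second vertex of the path, and once this neighbour
    is no longer new it closes a cycle of length at least three. *)
Lemma min_degree2_cycle (T : finType) (e : rel T) (x0 y0 : T) :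
    symmetric e -> irreflexive e -> e x0 y0 ->
    (forall x y, e x y -> exists2 z, e x z & z != y) ->
  exists2 s : seq T, (2 < size s)%N & ucycle e s.
Proof.
move=> esym eirr e0 deg2.
(* k bounds the number of vertices still available; the path x, y, p grows
   at x. *)
have extend k x y p : path e x (y :: p) -> uniq [:: x, y & p] ->
    (#|T| - size p <= k)%N -> exists2 s : seq T, (2 < size s)%N & ucycle e s.
  elim: k x y p => [|k IH] x y p pth unq szk.
    have := max_card (mem [:: x, y & p]); rewrite (card_uniqP unq) /=.
    by move: szk; rewrite leqn0 subn_eq0 => /[swap] /ltnW /leq_trans h /h; rewrite ltnn.
  have [z exz zy] := deg2 x y (andP pth).1.
  have zx : z != x by apply: contraTneq exz => ->; rewrite eirr.
  have [zp|zp] := boolP (z \in p).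
    case/splitPr: zp pth unq szk => p1 p2 pth unq _.
    exists (x :: y :: rcons p1 z); first by rewrite /= size_rcons.
    apply/andP; split.
      rewrite (cycle_path x) /= !last_rcons esym exz /=.
      move: pth; rewrite /= cat_path /= => /and4P [-> p1p zl _].
      by rewrite rcons_path p1p zl.
    move: unq; rewrite -!cat_cons -cat_rcons cat_uniq => /andP [].
    by rewrite !rcons_cons.
  apply: (IH z x (y :: p)).
  - by rewrite [path _ _ _]/= esym exz.
  - by rewrite cons_uniq !inE !negb_or zx zy zp.
  - by rewrite /= subnS; case: (#|T| - size p)%N szk.
apply: (extend #|T| x0 y0 [::]); rewrite /= ?andbT ?subn0 //.
by rewrite inE; apply: contraTneq e0 => ->; rewrite eirr.
Qed.
Section Forest.
Variables (R : realType) (n m : nat) (G : wgraph R n m).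

(** Let w be a relation between the rows, extended by zero to all edges.  At a
    vertex the signed sum of w over the incident edges vanishes, so an edge of
    the support is never alone at any of its endpoints; simplicity of the graph
    makes the second edge lead to a new neighbour. *)
Lemma forest_row_free (S : {set 'I_m}) :
  is_forest G S -> row_free (sub_incidence G S).
Proof.
move=> forS; rewrite -kermx_eq0; apply/negPn/negP => /rowV0Pn [v].
move=> /sub_kermxP vS v0.
pose w := v *m restr R S.
have wS : w *m incidence G = 0 by rewrite -mulmxA.
have w_out e : w 0 e != 0 -> e \in S.
  apply: contraR => eS; rewrite mxE big1 // => i _.
  rewrite mxE; case: eqP => [ie|]; last by rewrite mulr0.
  by case/negP: eS; rewrite -ie enum_valP.
have w_nz : exists e, w 0 e != 0.
  have /rV0Pn [i vi] := v0; exists (enum_val i).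
  rewrite mxE (bigD1 i) //= mxE eqxx mulr1 big1 ?addr0 // => j ji.
  by rewrite mxE (inj_eq enum_val_inj) (negPf ji) mulr0.
pose S' := [set e | w 0 e != 0]%SET.
have S'S : {subset S' <= S} by move=> e; rewrite inE => /w_out.
have [e0 we0] := w_nz.
have [] := @min_degree2_cycle _ (sub_adj G S') (wg_src G e0) (wg_tgt G e0).
- move=> i j; rewrite /sub_adj; apply: eq_existsb => e.
  by rewrite orbC.
- move=> i; apply/existsP => -[e /andP [_]]; rewrite orbb => /andP [/eqP <-].
  by rewrite eq_sym (negPf (wg_noloop G e)).
- by apply/existsP; exists e0; rewrite inE we0 !eqxx.
- move=> x y /existsP [e /andP [eS' exy]].
  have wx : (w *m incidence G) 0 x = 0 by rewrite wS mxE.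
  have we : w 0 e * incidence G e x != 0.
    rewrite mulf_neq0 //; first by rewrite inE in eS'.
    rewrite mxE; have := wg_noloop G e.
    case/orP: exy => /andP [/eqP -> /eqP ->] h.
      by rewrite eqxx (negPf h) subr0 oner_eq0.
    by rewrite eqxx [x == y]eq_sym (negPf h) sub0r oppr_eq0 oner_eq0.
  have [f fe wf] : exists2 f, f != e & w 0 f * incidence G f x != 0.
    apply: contrapT => nf; case/eqP: we; rewrite -wx [RHS]mxE (bigD1 e) //=.
    rewrite big1 ?addr0 // => f fe; apply/eqP/negPn/negP => wf.
    by apply: nf; exists f.
  have [wf0 incf] : w 0 f != 0 /\ incidence G f x != 0.
    by move: wf; rewrite mulf_eq0 negb_or => /andP.
  have other z : (wg_src G f == x) && (wg_tgt G f == z)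
      || (wg_src G f == z) && (wg_tgt G f == x) ->
      exists2 z, sub_adj G S' x z & z != y.
    move=> fxz; exists z; first by apply/existsP; exists f; rewrite inE wf0.
    apply: contraNneq fe => zy; apply/eqP/(wg_simple (w := G)).
    move: fxz exy; rewrite zy.
    case/orP=> /andP [/eqP -> /eqP ->]; case/orP=> /andP [/eqP -> /eqP ->];
      by [left | right].
  move: incf; rewrite mxE; have [xs|xs] := eqVneq x (wg_src G f).
    by move=> _; apply: (other (wg_tgt G f)); rewrite -xs !eqxx.
  have [xt|xt] := eqVneq x (wg_tgt G f); last by rewrite subrr eqxx.
  by move=> _; apply: (other (wg_src G f)); rewrite -xt !eqxx orbT.
move=> s s2 /andP [cs us]; apply: (forS s s2); rewrite /ucycle us andbT.
apply: sub_cycle cs => i j /existsP [e /andP [/S'S eS eij]].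
by apply/existsP; exists e; rewrite eS.
Qed.
End Forest.

(** * The Gram matrix of the preconditioned operator *)

Section Restriction.
Variables (R : realType) (m : nat).

Lemma restr_mul_tr (S : {set 'I_m}) : restr R S *m (restr R S)^T = 1%:M.
Proof.
apply/matrixP => i j; rewrite !mxE (bigD1 (enum_val i)) //= !mxE eqxx mul1r.
rewrite big1 ?addr0 => [|e ei]; first by rewrite (inj_eq enum_val_inj) eq_sym.
by rewrite mxE eq_sym (negPf ei) mul0r.
Qed.

Lemma restr_mul_tr_disjoint (S T : {set 'I_m}) :
  {in S, forall e, e \notin T} -> restr R S *m (restr R T)^T = 0.
Proof.
move=> dST; apply/matrixP => i j; rewrite !mxE big1 // => e _; rewrite !mxE.
case: eqP => [ie|]; last by rewrite mul0r.
case: eqP => [je|]; last by rewrite mulr0.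
by have := dST _ (enum_valP i); rewrite ie -je enum_valP.
Qed.

Lemma restr_tr_mul (S : {set 'I_m}) (e f : 'I_m) :
  ((restr R S)^T *m restr R S) e f = ((e \in S) && (e == f))%:R.
Proof.
rewrite mxE; have [eS|eS] := boolP (e \in S); last first.
  rewrite big1 // => i _; rewrite !mxE; case: eqP => [ie|]; last by rewrite mul0r.
  by case/negP: eS; rewrite -ie enum_valP.
rewrite (bigD1 (enum_rank_in eS e)) //= !mxE enum_rankK_in // eqxx mul1r.
rewrite big1 ?addr0 // => i ie; rewrite !mxE; case: eqP => [ei|]; last by rewrite mul0r.
by case/eqP: ie; apply: enum_val_inj; rewrite ei enum_rankK_in.
Qed.

Lemma edge_partition_disjoint L (E : 'I_L -> {set 'I_m}) k l :
  edge_partition E -> k != l -> {in E k, forall e, e \notin E l}.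
Proof.
move=> [_ uE] kl e ek; apply/negP => el; have [j [_ uj]] := uE e.
by case/eqP: kl; rewrite -(uj _ ek) -(uj _ el).
Qed.

Lemma sum_restr_tr_mul L (E : 'I_L -> {set 'I_m}) :
  edge_partition E -> \sum_(l < L) (restr R (E l))^T *m restr R (E l) = 1%:M.
Proof.
move=> [_ uE]; apply/matrixP => e f; rewrite summxE mxE.
have [j [ej uj]] := uE e.
rewrite (bigD1 j) //= restr_tr_mul ej big1 ?addr0 // => l lj.
rewrite restr_tr_mul; case: (boolP (e \in E l)) => // el.
by case/eqP: lj; rewrite (uj _ el).
Qed.

Lemma restr_diag (S : {set 'I_m}) (d : 'rV[R]_m) :
  restr R S *m diag_mx d = diag_mx (\row_i d 0 (enum_val i)) *m restr R S.
Proof.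
apply/matrixP => i e; rewrite mul_mx_diag mul_diag_mx !mxE mulrC.
by case: eqP => [->|]; rewrite ?mulr0.
Qed.
End Restriction.

Lemma psd_sum (R : realType) p (I : finType) (A : I -> 'M[R]_p) :
  (forall i, psd (A i)) -> psd (\sum_i A i).
Proof.
move=> pA; apply: (big_ind (@psd R p)) => //.
  by split=> [|x]; [rewrite trmx0 | rewrite mulmx0 mul0mx mxE].
move=> B C [Bs Bp] [Cs Cp]; split=> [|x]; first by rewrite linearD /= Bs Cs.
by rewrite mulmxDr mulmxDl mxE addr_ge0.
Qed.

Section Precond.
Variables (R : realType) (n m : nat) (G : wgraph R n m).

(** Only these properties of the diagonal matrix D of the weights matter: they
    let D cancel in the projections. *)
Lemma sub_wincidence_scaling (S : {set 'I_m}) :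
  exists2 D : 'M[R]_#|S|, D \in unitmx & D^T = D /\
    sub_wincidence G S = D *m sub_incidence G S.
Proof.
exists (diag_mx (\row_i wg_weight G (enum_val i))).
  rewrite unitmxE det_diag unitfE; apply/prodf_neq0 => i _.
  by rewrite mxE gt_eqF // wg_weight_gt0.
split; first exact: tr_diag_mx.
rewrite /sub_wincidence /wincidence mulmxA restr_diag mulmxA.
by congr (diag_mx _ *m _ *m _); apply/rowP => i; rewrite !mxE.
Qed.

Lemma sub_wincidence_gram_unit (S : {set 'I_m}) : is_forest G S ->
  sub_wincidence G S *m (sub_wincidence G S)^T \in unitmx.
Proof.
move=> /forest_row_free /gram_unitmx B.
have [D Du [Ds ->]] := sub_wincidence_scaling S.
by rewrite trmx_mul Ds mulmxA -(mulmxA D) !unitmx_mul Du B.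
Qed.

(** K_S = D N gives (D N)^T (D N N^T D)^{-1} (D N) = N^T (N N^T)^{-1} N: the
    projection onto the row space does not see the weights. *)
Lemma forest_projE (S : {set 'I_m}) : is_forest G S ->
  (sub_wincidence G S)^T *m invmx (sub_wincidence G S *m (sub_wincidence G S)^T)
    *m sub_wincidence G S = forest_proj G S.
Proof.
move=> /forest_row_free /gram_unitmx Bu.
have [D Du [Ds ->]] := sub_wincidence_scaling S.
rewrite /forest_proj; set N := sub_incidence G S; set B := N *m N^T in Bu *.
suff -> : invmx (D *m N *m (D *m N)^T) = invmx D *m invmx B *m invmx D.
  by rewrite trmx_mul Ds !mulmxA mulmxK // mulmxKV.
have -> : D *m N *m (D *m N)^T = D *m B *m D by rewrite trmx_mul Ds !mulmxA.
have U : D *m B *m D \in unitmx by rewrite !unitmx_mul Du Bu.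
by clearbody B; rewrite -[RHS](mulKmx U) !mulmxA !mulmxK.
Qed.

Lemma forest_proj_sym (S : {set 'I_m}) : (forest_proj G S)^T = forest_proj G S.
Proof.
rewrite /forest_proj; move: (sub_incidence G S) => N.
by rewrite !trmx_mul trmx_inv trmx_mul trmxK mulmxA.
Qed.

Lemma forest_proj_idem (S : {set 'I_m}) : is_forest G S ->
  forest_proj G S *m forest_proj G S = forest_proj G S.
Proof.
move=> /forest_row_free /gram_unitmx Bu.
rewrite /forest_proj; move: (sub_incidence G S) Bu => N Bu.
by rewrite !mulmxA -[_ *m N *m N^T]mulmxA mulmxKV.
Qed.

Lemma forest_proj_neq0 (S : {set 'I_m}) : is_forest G S -> (0 < #|S|)%N ->
  forest_proj G S != 0.
Proof.
move=> /forest_row_free fS S0; apply/eqP => P0.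
have Bu := gram_unitmx fS; move: P0; rewrite /forest_proj.
move: (sub_incidence G S) fS Bu => N fN Bu /(congr1 (mulmx N)).
rewrite !mulmxA mulmxV // mul1mx mulmx0 => N0.
by move: fN; rewrite N0 /row_free mxrank0 => /eqP S0'; rewrite -S0' in S0.
Qed.

Variables (L : nat) (E : 'I_L -> {set 'I_m}).
Hypotheses (Epart : edge_partition E) (Eforest : forall l, is_forest G (E l)).

Let gram l := sub_wincidence G (E l) *m (sub_wincidence G (E l))^T.

(** T is block diagonal along the edge partition, so it is inverted block by
    block. *)
Lemma precond_mul_inv :
  precond G E *m
    \sum_(l < L) (restr R (E l))^T *m invmx (gram l) *m restr R (E l) = 1%:M.
Proof.
rewrite -(sum_restr_tr_mul R Epart) mulmx_suml; apply: eq_bigr => l _.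
rewrite mulmx_sumr (bigD1 l) //= big1 => [|k kl]; last first.
  rewrite !mulmxA -[_ *m restr R _ *m _]mulmxA restr_mul_tr_disjoint.
    by rewrite mulmx0 !mul0mx.
  by apply: edge_partition_disjoint; rewrite // eq_sym.
rewrite addr0 -/(gram l); have := sub_wincidence_gram_unit (@Eforest l).
rewrite -/(gram l); move: (gram l) => C Cu.
by rewrite -!mulmxA (mulmxA (restr R (E l))) restr_mul_tr mul1mx mulKVmx.
Qed.

Lemma psd_precond : psd (precond G E).
Proof.
apply: psd_sum => l; move: (restr R (E l)) (sub_wincidence G (E l)) => P K.
have -> : P^T *m (K *m K^T) *m P = (P^T *m K) *m (P^T *m K)^T.
  by rewrite trmx_mul trmxK !mulmxA.
exact: psd_gram.
Qed.

Lemma preconditioned_gram :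
  let A := invmx (sqrtmx (precond G E)) *m wincidence G in
  A^T *m A = \sum_(l < L) forest_proj G (E l).
Proof.
have [[Ss _] SS] := sqrtmxP psd_precond.
set S := sqrtmx _ in Ss SS *; move=> A.
have [Tu _] := mulmx1_unit precond_mul_inv.
have Su : S \in unitmx by move: Tu; rewrite -SS unitmx_mul => /andP [].
have -> : A^T *m A = (wincidence G)^T *m (invmx S *m invmx S) *m wincidence G.
  by rewrite /A trmx_mul trmx_inv Ss !mulmxA.
have -> : invmx S *m invmx S =
    \sum_(l < L) (restr R (E l))^T *m invmx (gram l) *m restr R (E l).
  set X := \sum_l _; have -> : X = invmx S *m (invmx S *m (S *m S *m X)).
    by rewrite -mulmxA !mulKmx.
  by rewrite SS precond_mul_inv mulmx1.
rewrite mulmx_sumr mulmx_suml; apply: eq_bigr => l _.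
rewrite -forest_projE // -/(gram l); move: (gram l) => C.
rewrite /sub_wincidence; move: (wincidence G) => K.
by rewrite trmx_mul !mulmxA.
Qed.
End Precond.

(** * Sums of nested orthogonal projections *)

Lemma sym_eigenvalueP (F : fieldType) p (A : 'M[F]_p) a : A^T = A ->
  reflect (exists2 x : 'cV_p, A *m x = a *: x & x != 0) (eigenvalue A a).
Proof.
move=> As; apply: (iffP eigenvalueP) => -[v Av v0]; exists v^T; rewrite ?trmx_eq0 //.
  by rewrite -{1}As -trmx_mul Av linearZ.
by rewrite -{1}As -trmx_mul Av linearZ.
Qed.

Lemma mulmx_ext (F : nzRingType) p q (A B : 'M[F]_(p, q)) :
  (forall x : 'cV_q, A *m x = B *m x) -> A = B.
Proof.
move=> AB; apply/matrixP => i j.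
by have /matrixP/(_ i 0) := AB (delta_mx j 0); rewrite -!colE !mxE.
Qed.

(** Comparing consecutive indices suffices for a preorder; the bound b restricts
    this to an initial segment, as needed both for the decreasing chain of all
    ranges and for the equalities among the first ones. *)
Lemma ord_chain L (r : 'I_L -> 'I_L -> Prop) (b : nat) :
    (forall k, r k k) -> (forall j k l, r j k -> r k l -> r j l) ->
    (forall k l : 'I_L, nat_of_ord l = k.+1 -> (l < b)%N -> r k l) ->
  forall k l : 'I_L, (k <= l)%N -> (l < b)%N -> r k l.
Proof.
move=> rr rt rS k; case=> l lL; elim: l lL => [|l IH] lL /=.
  by rewrite leqn0 => /eqP k0 _; rewrite (_ : Ordinal lL = k) //; apply: val_inj.
rewrite leq_eqVlt => /predU1P [kl _|kl lb].
  by rewrite (_ : Ordinal lL = k) //; apply: val_inj.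
apply: (rt _ (Ordinal (ltnW lL))); first by apply: IH; rewrite // ltnW.
exact: rS.
Qed.

Section Projections.
Variables (R : realType) (n : nat).
Implicit Types P Q : 'M[R]_n.

Lemma ran_proj P Q : P *m P = P ->
  ran Q `<=` ran P <-> P *m Q = Q.
Proof.
move=> PP; split=> [QP|PQ _ [x _ <-]]; last first.
  by exists (Q *m x) => //; rewrite mulmxA PQ.
apply: mulmx_ext => x; rewrite -mulmxA.
have [|y _ <-] := QP (Q *m x); first by exists x.
by rewrite mulmxA PP.
Qed.

Lemma proj_quadratic P (x : 'cV[R]_n) : P^T = P -> P *m P = P ->
  x^T *m P *m x = (P *m x)^T *m (P *m x).
Proof. by move=> Ps PP; rewrite trmx_mul Ps !mulmxA -(mulmxA _ P P) PP. Qed.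

(** The difference of the two sides is |x - P x|^2. *)
Lemma proj_quadratic_le P (x : 'cV[R]_n) : P^T = P -> P *m P = P ->
  (x^T *m P *m x) ord0 ord0 <= (x^T *m x) ord0 ord0.
Proof.
move=> Ps PP; have := sqnorm_ge0 (x - P *m x).
have -> : (x - P *m x)^T *m (x - P *m x) = x^T *m x - x^T *m P *m x.
  rewrite [(_ - _)^T]linearB /= trmx_mul Ps mulmxBl !mulmxBr !mulmxA.
  by rewrite -(mulmxA _ P P) PP subrr subr0.
by rewrite !mxE subr_ge0.
Qed.

Variables (L lh : nat) (Q : 'I_L -> 'M[R]_n).
Hypotheses (lh_gt0 : (0 < lh)%N) (lh_ltL : (lh < L)%N).
Hypotheses (Qsym : forall l, (Q l)^T = Q l) (Qidem : forall l, Q l *m Q l = Q l).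
Hypothesis Qnested : forall k l : 'I_L, nat_of_ord l = (nat_of_ord k).+1 ->
      [/\ (l < lh)%N -> ran (Q k) = ran (Q l),
          nat_of_ord l = lh -> ran (Q l) `<` ran (Q k)
        & (lh < l)%N -> ran (Q l) `<=` ran (Q k)].
Hypothesis Qneq0 : forall l, Q l != 0.

Let M := \sum_(l < L) Q l.

Let Msym : M^T = M.
Proof. by rewrite /M linear_sum /=; apply: eq_bigr => l _. Qed.

Lemma nested_mul (k l : 'I_L) : (k <= l)%N -> Q k *m Q l = Q l.
Proof.
move=> kl; apply/ran_proj => //; move: k l kl (ltn_ord l).
apply: ord_chain => [k|j k l jk kl|k l kl _]; first exact: subset_refl.
  exact: subset_trans kl jk.
have [h1 h2 h3] := Qnested kl.
have [llh|llh|llh] := ltngtP l lh; [by rewrite h1 | exact: h3 | exact: (h2 llh).1].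
Qed.

Lemma nested_mul_sym (k l : 'I_L) : (k <= l)%N -> Q l *m Q k = Q l.
Proof. by move=> /nested_mul /(congr1 trmx); rewrite trmx_mul !Qsym. Qed.

(** The first lh ranges are equal and contain all the others. *)
Lemma nested_top (k l : 'I_L) : (k < lh)%N -> Q k *m Q l = Q l.
Proof.
move=> klh; have [kl|/ltnW lk] := leqP k l; first exact: nested_mul.
apply/ran_proj => //; move: l k lk klh.
apply: ord_chain => [k|j k l jk kl|k l kl llh]; first exact: subset_refl.
  exact: subset_trans jk kl.
by have [eq_ran _ _] := Qnested kl; rewrite eq_ran.
Qed.

(** An eigenvector for a != 0 is M x / a, hence lies in the common range of the
    first lh projections; these contribute |x|^2 each to a |x|^2, the others
    between 0 and |x|^2. *)
Lemma nested_sum_eigenvalue_bounds a : eigenvalue M a -> a != 0 ->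
  lh%:R <= a <= L%:R.
Proof.
move=> /(sym_eigenvalueP a Msym) [x Mx x0] a0.
have Qx (l : 'I_L) : (l < lh)%N -> Q l *m x = x.
  move=> llh; apply: (scalerI a0); rewrite scalemxAr -Mx mulmxA /M mulmx_sumr.
  by congr (_ *m _); apply: eq_bigr => k _; apply: nested_top.
have xx0 : 0 < (x^T *m x) ord0 ord0 by rewrite sqnorm_gt0.
have aE : a * (x^T *m x) ord0 ord0 = \sum_l (x^T *m Q l *m x) ord0 ord0.
  rewrite -summxE -mulmx_suml -mulmx_sumr -/M -mulmxA Mx -scalemxAr.
  by rewrite [RHS]mxE.
rewrite -(ler_pM2r xx0) -[X in _ && X](ler_pM2r xx0) aE; apply/andP; split.
  have -> : lh%:R * (x^T *m x) ord0 ord0 =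
      \sum_(l < L | (l < lh)%N) (x^T *m Q l *m x) ord0 ord0.
    rewrite (eq_bigr (fun=> (x^T *m x) ord0 ord0)); last first.
      by move=> l llh; rewrite -mulmxA Qx.
    by rewrite (big_ord_narrow (ltnW lh_ltL)) /= sumr_const card_ord mulr_natl.
  rewrite [leRHS](bigID (fun l : 'I_L => (l < lh)%N)) /= lerDl sumr_ge0 // => l _.
  by rewrite proj_quadratic ?sqnorm_ge0.
rewrite mulr_natl -[L in leRHS]card_ord -sumr_const ler_sum // => l _.
exact: proj_quadratic_le.
Qed.

(** The smallest range lies in all the others, so M is multiplication by L on
    it. *)
Lemma nested_sum_eigenvalue_max : eigenvalue M L%:R.
Proof.
have lL : (L.-1 < L)%N by rewrite ltn_predL (leq_trans _ lh_ltL).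
pose l := Ordinal lL.
have [x Qx] : exists x : 'cV_n, Q l *m x != 0.
  apply: contrapT => Q0; case/eqP: (Qneq0 l); apply: mulmx_ext => x.
  by rewrite mul0mx; apply/eqP/negPn/negP => Qx; apply: Q0; exists x.
apply/(sym_eigenvalueP _ Msym); exists (Q l *m x) => //.
rewrite /M mulmx_suml (eq_bigr (fun=> Q l *m x)) => [|k _].
  by rewrite sumr_const card_ord scaler_nat.
by rewrite mulmxA nested_mul //= -ltnS prednK // (leq_trans _ lh_ltL).
Qed.

(** The witness is the component, orthogonal to the range of index lh, of a
    vector of the preceding range outside it: the first lh projections fix it,
    the others kill it. *)
Lemma nested_sum_eigenvalue_min : eigenvalue M lh%:R.
Proof.
pose l := Ordinal lh_ltL.
have pL : (lh.-1 < L)%N by rewrite (leq_ltn_trans (leq_pred _)).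
pose p := Ordinal pL.
have [|_ /(_ erefl) [_ np] _] := Qnested (k := p) (l := l).
  by rewrite /= prednK.
have [_ [x _ <-] xl] : exists2 y, ran (Q p) y & ~ ran (Q l) y.
  by apply: contrapT => h; apply: np => y py; apply: contrapT => ly; apply: h; exists y.
apply/(sym_eigenvalueP _ Msym).
exists (Q p *m x - Q l *m (Q p *m x)); last first.
  rewrite subr_eq0; apply: contra_notN xl => /eqP ->.
  by exists (Q p *m x).
set y := _ - _.
rewrite /M mulmx_suml (bigID (fun k : 'I_L => (k < lh)%N)) /=.
rewrite [X in _ + X]big1 ?addr0 => [|k]; last first.
  rewrite -leqNgt => lk; rewrite /y mulmxBr !mulmxA.
  by rewrite (nested_mul_sym (k := l)) // subrr.
rewrite (eq_bigr (fun=> y)) => [|k klh].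
  by rewrite (big_ord_narrow (ltnW lh_ltL)) /= sumr_const card_ord scaler_nat.
by rewrite /y mulmxBr !mulmxA !(nested_top _ klh).
Qed.
End Projections.

(** * The condition number *)

Lemma cond_number_extremes (R : realType) p q (A : 'M[R]_(p, q)) (a b : R) :
    0 < a -> eigenvalue (A^T *m A) a -> eigenvalue (A^T *m A) b ->
    (forall c, eigenvalue (A^T *m A) c -> c != 0 -> a <= c <= b) ->
  cond_number A = Num.sqrt (b / a).
Proof.
move=> a0 ea eb bnd.
have /andP [ab _] : a <= a <= b by rewrite bnd ?gt_eqF.
have b0 : 0 < b.
  by have /andP [_ /(lt_le_trans a0)] : a <= a <= b by rewrite bnd ?gt_eqF.
have sv c : 0 < c -> eigenvalue (A^T *m A) c -> singular_value A (Num.sqrt c).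
  by move=> c0 ec; split; rewrite ?sqrtr_ge0 // sqr_sqrtr // ltW.
have svP s : singular_value A s -> s != 0 -> Num.sqrt a <= s <= Num.sqrt b.
  move=> [s0 es] sn; have /andP [as_ sb] := bnd _ es (expf_neq0 2 sn).
  by rewrite -[s]ger0_norm // -sqrtr_sqr !ler_wsqrtr.
have ubb : ubound (singular_value A) (Num.sqrt b).
  move=> s As; have [->|s0] := eqVneq s 0; first exact: sqrtr_ge0.
  by have /andP [] := svP s As s0.
have lba : lbound [set s | singular_value A s /\ s != 0] (Num.sqrt a).
  by move=> s [As s0]; have /andP [] := svP s As s0.
have -> : cond_number A = Num.sqrt b / Num.sqrt a.
  congr (_ / _).
    apply/eqP; rewrite eq_le; apply/andP; split.
      by apply: ge_sup => //; exists (Num.sqrt b); apply: sv.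
    apply: ub_le_sup; last exact: sv.
    by exists (Num.sqrt b).
  have Sa : [set s | singular_value A s /\ s != 0] (Num.sqrt a).
    by split; [exact: sv | rewrite gt_eqF // sqrtr_gt0].
  apply/eqP; rewrite eq_le; apply/andP; split.
    by apply: ge_inf => //; exists (Num.sqrt a).
  by apply: lb_le_inf => //; exists (Num.sqrt a).
by rewrite -sqrtrV ?ltW // -sqrtrM ?ltW.
Qed.

(* The index l = 1, ..., L is shifted to 'I_L = {0, ..., L-1}, so the first lh
   forests are those with l < lh. *)
Theorem theorem3 (R : realType) (n m : nat) (G : wgraph R n m)
    (L : nat) (E : 'I_L -> {set 'I_m}) (lh : nat)
    (Epart : edge_partition E)
    (Eforest : forall l : 'I_L, is_forest G (E l))
    (lh_gt0 : (1 <= lh)%N) (lh_ltL : (lh < L)%N)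
    (Enested : forall k l : 'I_L, nat_of_ord l = (nat_of_ord k).+1 ->
      [/\ (l < lh)%N ->
            ran (forest_proj G (E k)) = ran (forest_proj G (E l)),
          nat_of_ord l = lh ->
            ran (forest_proj G (E l)) `<` ran (forest_proj G (E k))
        & (lh < l)%N ->
            ran (forest_proj G (E l)) `<=` ran (forest_proj G (E k))]) :
  cond_number (invmx (sqrtmx (precond G E)) *m wincidence G)
    = Num.sqrt (L%:R / lh%:R).
Proof.
have Qsym l := forest_proj_sym G (E l).
have Qidem l := forest_proj_idem (Eforest l).
apply: cond_number_extremes; first by rewrite ltr0n.
- by rewrite preconditioned_gram //; apply: nested_sum_eigenvalue_min.
- rewrite preconditioned_gram //; apply: nested_sum_eigenvalue_max Enested _ => //.
  by move=> l; apply: forest_proj_neq0 => //; apply: Epart.1.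
- by move=> c; rewrite preconditioned_gram //; apply: nested_sum_eigenvalue_bounds.
Qed.
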